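(* Let $(D,A_0)$ be an extended Hecke datum, where $A$ is free over $A_0$ with basis $\{c_i\}_{i\in I}$, and let $\Lambda$ be a pre-$D$-graph with finitely many vertices and finitely many edges. For any $y\in V^\Lambda$ and any $r\ne s$ in $S$ with $m_{r,s}<\infty$, $$(\rho_r^{\Lambda}\rho_s^{\Lambda}\rho_r^{\Lambda}\cdots)_{m_{r,s}}(y)-(\rho_s^{\Lambda}\rho_r^{\Lambda}\rho_s^{\Lambda}\cdots)_{m_{r,s}}(y)=y\,\psi_{r,s}\Big(\sum_{i,p}c_iX^{r,s,x_y}_{p,i}\,p\Big),$$ where $x_y$ is the vertex of the universal pre-$D$-graph $\Gamma^{\mathcal{U}}$ with respect to $r,s$ with $\mathcal{L}^{\Gamma^{\mathcal{U}}}(x_y)=\mathcal{L}^{\Lambda}(y)\cap\{r,s\}$. Moreover, a generating set for the ideal $J_0^\Lambda$ is $$\Big\{\,y\sum_pX^{r,s,x_y}_{p,i}\,\psi_{r,s}(p)\ \Big|\ r\neq s\in S,\ m_{r,s}<\infty,\ i\in I,\ y\in V^\Lambda\Big\}.$$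
   Context: A Hecke datum $D=(W,S,A,(a_r)_{r\in S},(b_r)_{r\in S})$ consists of a Coxeter system $(W,S)$, a commutative unital ring $A$, and families $(a_r),(b_r)$ in $A$ with $a_r=a_s$, $b_r=b_s$ whenever $r,s\in S$ are conjugate in $W$; $m_{r,s}$ is the order of $rs$, and $(xyx\cdots)_m$ denotes the alternating product with $m$ factors. An extended Hecke datum $(D,A_0)$ is a Hecke datum with a subring $A_0\subseteq A$, $1_{A_0}=1_A$, such that $A$ is a free $A_0$-module with some basis $\{c_i\}_{i\in I}$. A quiver $\Gamma$ has vertex set $V^\Gamma$, edge set $E^\Gamma$, source and target maps $s,t$; an edge $e$ with target $x$ and source $y$ is written $x\xleftarrow{e}y$. Paths are sequences $(e_1,\dots,e_n)$ with $s(e_i)=t(e_{i+1})$, with target $t(e_1)$ and source $s(e_n)$; paths of length $0$ are the vertices. The path algebra $A[\Gamma]$ (similarly $A_0[\Gamma]$) is the free module on the set $P^\Gamma$ of paths, with product $pq$ = concatenation if $s(p)=t(q)$, and $0$ otherwise. A pre-$D$-graph is a quiver $\Gamma$ with a map $\mathcal{L}^\Gamma:V^\Gamma\to\mathcal{P}(S)$ such that for any $x$, $r$ with $r\notin\mathcal{L}^\Gamma(x)$ there are only finitely many $y$, $e$ with $r\in\mathcal{L}^\Gamma(y)$ and $x\xleftarrow{e}y$. For $r\in S$, $\rho^\Gamma_r$ is the left $A[\Gamma]$-module endomorphism of $A[\Gamma]$ with $\rho^\Gamma_r(x)=a_rx+\sum_{y,e\,:\,x\xleftarrow{e}y,\ r\in\mathcal{L}^\Gamma(y)}(x\xleftarrow{e}y)$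 if $r\notin\mathcal{L}^\Gamma(x)$ and $\rho^\Gamma_r(x)=-b_rx$ if $r\in\mathcal{L}^\Gamma(x)$, for $x\in V^\Gamma$. For $x\in V^\Gamma$ and $r\neq s$ with $m_{r,s}<\infty$, the expression $\big((\rho^\Gamma_r\rho^\Gamma_s\rho^\Gamma_r\cdots)_{m_{r,s}}-(\rho^\Gamma_s\rho^\Gamma_r\rho^\Gamma_s\cdots)_{m_{r,s}}\big)(x)$ is written uniquely as $\sum_{i\in I}\sum_{p\in P^\Gamma}c_iX^{r,s,x}_{p,i}\,p$ with $X^{r,s,x}_{p,i}\in A_0$. $J^\Gamma_0$ is the two-sided ideal of $A_0[\Gamma]$ generated by all $\sum_pX^{r,s,x}_{p,i}p$ ($x\in V^\Gamma$, $i\in I$, $r\neq s$ with $m_{r,s}<\infty$). The universal pre-$D$-graph $\Gamma^{\mathcal U}$ with respect to $r\ne s$ is the complete quiver (exactly one edge from each vertex to each vertex, including a loop at each vertex) on $\{x_r,x_s,x_\varnothing,x_\wp\}$ with $\mathcal{L}(x_r)=\{r\}$, $\mathcal{L}(x_s)=\{s\}$, $\mathcal{L}(x_\varnothing)=\emptyset$, $\mathcal{L}(x_\wp)=\{r,s\}$. In the claim, $X^{r,s,x_y}_{p,i}$ denotes the coefficients computed on $\Gamma^{\mathcal U}$, with $p$ ranging over paths of $\Gamma^{\mathcal U}$. For $x\in V^{\Gamma^{\mathcal U}}$ put $V^\Lambda_x=\{y\in V^\Lambda\mid\mathcal{L}^\Lambda(y)\cap\{r,s\}=\mathcal{L}^{\Gamma^{\mathcal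 U}}(x)\}$. $\psi_{r,s}:A[\Gamma^{\mathcal U}]\to A[\Lambda]$ is the $A$-algebra homomorphism with $\psi_{r,s}(x)=\sum_{y\in V^\Lambda_x}y$ for vertices $x$, and $\psi_{r,s}(x_1\leftarrow x_2)=\sum f$, summed over all edges $y_1\xleftarrow{f}y_2$ of $\Lambda$ with $y_1\in V^\Lambda_{x_1}$, $y_2\in V^\Lambda_{x_2}$. *)

(* Defs.v *)
From HB Require Import structures.
From mathcomp Require Import all_boot ssralg finmap.
From mathcomp Require Import mathcomp_extra boolp classical_sets functions.
From mathcomp Require Import cardinality fsbigop.
From mathcomp Require Import monalg.

Set Implicit Arguments.
Unset Strict Implicit.
Unset Printing Implicit Defensive.

Import GRing.Theory.

Local Open Scope classical_set_scope.
Local Open Scope ring_scope.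

Definition has_order (G : groupType) (g : G) (n : nat) : Prop :=
  [/\ (0 < n)%N, (g ^+ n = 1)%g &
      forall k : nat, (0 < k)%N -> (g ^+ k = 1)%g -> (n <= k)%N].

(* The value 0 encodes infinite order. *)
Definition group_order (G : groupType) (g : G) : nat := xget 0%N (has_order g).

(* [W] is the group presented by the generators [S] and the relations
   (r s)^(m_{r,s}) = 1 for m_{r,s} < oo, where m_{r,s} is the order of r s. *)
Definition coxeter_system (W : groupType) (S : set W) : Prop :=
  [/\ forall s : S, (val s * val s = 1)%g,
      forall w : W, exists l : seq S, w = (\prod_(s <- l) val s)%g &
      forall (G : groupType) (f : S -> G),
        (forall r s : S, (0 < group_order (val r * val s)%g)%N ->
           ((f r * f s) ^+ group_order (val r * val s) = 1)%g) ->
        exists phi : {multiplicative W -> G}, forall s : S, phi (val s) = f s].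

Record hecke_datum := HeckeDatum {
  hW : groupType;
  hS : set hW;
  h_coxeter : coxeter_system hS;
  hA : comPzRingType;
  ha : hS -> hA;
  hb : hS -> hA;
  ha_conj : forall (r s : hS) (w : hW), val s = (val r ^ w)%g -> ha r = ha s;
  hb_conj : forall (r s : hS) (w : hW), val s = (val r ^ w)%g -> hb r = hb s
}.

Arguments hS : clear implicits.

(* m_{r,s}, with 0 standing for infinity. *)
Definition cox_m (D : hecke_datum) (r s : hS D) : nat :=
  group_order (val r * val s)%g.

Definition is_basis (A : comPzRingType) (A0 : subringClosed A)
    (I : choiceType) (c : I -> A) : Prop :=
  forall a : A, exists! x : I -> A,
    [/\ forall i, x i \in A0, finite_set [set i | x i != 0] &
        a = \sum_(i \in [set: I]) c i * x i].

Record ext_hecke_datum := ExtHeckeDatum {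
  e_datum :> hecke_datum;
  e_A0 : subringClosed (hA e_datum);
  e_I : choiceType;
  e_c : e_I -> hA e_datum;
  e_basis : is_basis e_A0 e_c
}.

Record quiver := Quiver {
  vert : choiceType;
  edge : choiceType;
  src : edge -> vert;
  tgt : edge -> vert
}.

(* A path is given by its target vertex and its sequence of edges
   (e_1, ..., e_n) with s(e_i) = t(e_{i+1}); the vertex [x] is the path
   (x, [::]).  For n > 0 the first component is forced to be t(e_1). *)
Fixpoint is_path (Q : quiver) (x : vert Q) (es : seq (edge Q)) : bool :=
  if es is e :: es' then (tgt e == x) && is_path (src e) es' else true.

Record qpath (Q : quiver) := QPath {
  path_data : vert Q * seq (edge Q);
  path_dataP : is_path path_data.1 path_data.2
}.

HB.instance Definition _ (Q : quiver) := [isSub for @path_data Q].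
HB.instance Definition _ (Q : quiver) := [Choice of qpath Q by <:].

Section Paths.
Variable Q : quiver.
Implicit Types (p q : qpath Q) (x : vert Q) (e : edge Q).

Definition ptgt p : vert Q := (val p).1.
Definition pedges p : seq (edge Q) := (val p).2.
Definition psrc p : vert Q := last (ptgt p) (map (@src Q) (pedges p)).

Definition vpath x : qpath Q := @QPath Q (x, [::]) isT.

Lemma is_path_edge e : is_path (tgt e) [:: e].
Proof. by rewrite /= eqxx. Qed.

Definition epath e : qpath Q := @QPath Q (tgt e, [:: e]) (is_path_edge e).

(* Concatenation; the value is only meaningful when [psrc p = ptgt q]. *)
Definition pcat p q : qpath Q := insubd p (ptgt p, pedges p ++ pedges q).

Lemma is_path_cat x es1 es2 :
  is_path x (es1 ++ es2) =
  is_path x es1 && is_path (last x (map (@src Q) es1)) es2.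
Proof. by elim: es1 x => //= e es1 IH x; rewrite IH andbA. Qed.

Lemma val_pcat p q : psrc p = ptgt q ->
  val (pcat p q) = (ptgt p, pedges p ++ pedges q).
Proof.
move=> pq; rewrite insubdK // /in_mem /= is_path_cat.
rewrite -[ptgt p]/((val p).1) -[pedges p]/((val p).2) (valP p) /=.
by rewrite -/(psrc p) pq; apply: (valP q).
Qed.

Lemma ptgt_pcat p q : psrc p = ptgt q -> ptgt (pcat p q) = ptgt p.
Proof. by move=> pq; rewrite {1}/ptgt val_pcat. Qed.

Lemma pedges_pcat p q :
  psrc p = ptgt q -> pedges (pcat p q) = pedges p ++ pedges q.
Proof. by move=> pq; rewrite {1}/pedges val_pcat. Qed.

Lemma psrc_pcat p q : psrc p = ptgt q -> psrc (pcat p q) = psrc q.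
Proof.
move=> pq; rewrite {1}/psrc ptgt_pcat // pedges_pcat // map_cat last_cat.
by rewrite -/(psrc p) pq.
Qed.

Lemma qpath_eq p q : ptgt p = ptgt q -> pedges p = pedges q -> p = q.
Proof.
move=> h1 h2; apply: val_inj; move: h1 h2; rewrite /ptgt /pedges.
by case: (val p) (val q) => [x s] [y t] /= -> ->.
Qed.

Lemma pcatA p q t : psrc p = ptgt q -> psrc q = ptgt t ->
  pcat p (pcat q t) = pcat (pcat p q) t.
Proof.
move=> pq qt.
have p_qt : psrc p = ptgt (pcat q t) by rewrite ptgt_pcat.
have pq_t : psrc (pcat p q) = ptgt t by rewrite psrc_pcat.
by apply: qpath_eq; rewrite ?(ptgt_pcat, pedges_pcat) // catA.
Qed.

Lemma pcat_vr p : pcat p (vpath (psrc p)) = p.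
Proof. by apply: qpath_eq; rewrite ?(ptgt_pcat, pedges_pcat) // cats0. Qed.

Lemma pcat_vl p : pcat (vpath (ptgt p)) p = p.
Proof. by apply: qpath_eq; rewrite ?(ptgt_pcat, pedges_pcat). Qed.

Lemma psrc_epath e : psrc (epath e) = src e. Proof. by []. Qed.

End Paths.

Definition path_alg (A : comPzRingType) (Q : quiver) : Type :=
  {malg A[qpath Q]}.

HB.instance Definition _ A Q := GRing.Zmodule.on (path_alg A Q).

(* A path as an element of A[Q]; locked only for the sake of unification. *)
HB.lock Definition of_path (A : comPzRingType) (Q : quiver) (p : qpath Q) :
  path_alg A Q := << 1 *g p >>.
Canonical of_path_unlockable := Unlockable of_path.unlock.
Arguments of_path {A Q} p.

Section PathAlgModule.
Variables (A : comPzRingType) (Q : quiver).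
Implicit Types (u v : path_alg A Q) (a : A) (p : qpath Q).

Definition coeff u p : A := u@_p.

Definition pscale a u : path_alg A Q :=
  [malg p in msupp u => a * coeff u p].

Lemma coeff_pscale a u p : coeff (pscale a u) p = a * coeff u p.
Proof.
rewrite /coeff /pscale mcoeffE; case: ifP => // /negbT.
by rewrite -mcoeff_eq0 => /eqP ->; rewrite mulr0.
Qed.

Lemma coeffP u v : (forall p, coeff u p = coeff v p) -> u = v.
Proof. by move=> h; apply/malgP. Qed.

Lemma coeffD u v p : coeff (u + v) p = coeff u p + coeff v p.
Proof. exact: mcoeffD. Qed.

Lemma pscaleA a b u : pscale a (pscale b u) = pscale (a * b) u.
Proof. by apply: coeffP => p; rewrite !coeff_pscale mulrA. Qed.

Lemma pscale1 u : pscale 1 u = u.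
Proof. by apply: coeffP => p; rewrite !coeff_pscale mul1r. Qed.

Lemma pscaleDr a u v : pscale a (u + v) = pscale a u + pscale a v.
Proof. by apply: coeffP => p; rewrite !(coeffD, coeff_pscale) mulrDr. Qed.

Lemma pscaleDl u a b : pscale (a + b) u = pscale a u + pscale b u.
Proof. by apply: coeffP => p; rewrite !(coeffD, coeff_pscale) mulrDl. Qed.

HB.instance Definition _ := GRing.Zmodule_isLmodule.Build A (path_alg A Q)
  pscaleA pscale1 pscaleDr pscaleDl.

Lemma coeffZ a u p : coeff (a *: u) p = a * coeff u p.
Proof. exact: coeff_pscale. Qed.

Definition lin_ext (M : lmodType A) (f : qpath Q -> M) (u : path_alg A Q) : M :=
  \sum_(p <- msupp u) coeff u p *: f p.

Lemma lin_extEw (M : lmodType A) (f : qpath Q -> M) u (X : {fset qpath Q}) :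
  {subset msupp u <= X} -> lin_ext f u = \sum_(p <- X) coeff u p *: f p.
Proof.
move=> sub; rewrite /lin_ext; apply: big_fset_incl; first exact/fsubsetP.
by move=> p _; rewrite -mcoeff_eq0 => /eqP up; rewrite /coeff up scale0r.
Qed.

Lemma lin_ext_linear (M : lmodType A) (f : qpath Q -> M) : linear (lin_ext f).
Proof.
move=> a u v.
pose X := (msupp u `|` msupp v `|` msupp (a *: u + v))%fset.
have sX w : (msupp w `<=` X)%fset -> {subset msupp w <= X} by move/fsubsetP.
rewrite !(@lin_extEw _ _ _ X); first last.
- by apply: sX; apply: fsubsetUr.
- by apply: sX; apply: fsubset_trans (fsubsetUl _ _); apply: fsubsetUl.
- by apply: sX; apply: fsubset_trans (fsubsetUl _ _); apply: fsubsetUr.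
rewrite scaler_sumr -big_split /=; apply: eq_bigr => p _.
by rewrite coeffD coeffZ scalerDl scalerA.
Qed.

HB.instance Definition _ (M : lmodType A) (f : qpath Q -> M) :=
  GRing.isLinear.Build A (path_alg A Q) M *:%R (lin_ext f) (lin_ext_linear f).

Lemma lin_ext_path (M : lmodType A) (f : qpath Q -> M) p :
  lin_ext f (of_path p) = f p.
Proof.
rewrite (@lin_extEw _ _ _ [fset p]%fset); last first.
  by apply/fsubsetP; rewrite unlock; apply: msuppU_le.
by rewrite big_seq_fset1 /coeff unlock mcoeffUU scale1r.
Qed.

Lemma path_algE u : u = lin_ext of_path u.
Proof.
rewrite {1}[u](monalgE u) /lin_ext; apply: eq_bigr => p _; apply: coeffP => q.
by rewrite coeffZ unlock [LHS]mcoeffU [X in _ * X]mcoeffU mulrnAr mulr1.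
Qed.

Lemma lin_eq (M : lmodType A) (f g : {linear path_alg A Q -> M}) :
  (forall p, f (of_path p) = g (of_path p)) -> f =1 g.
Proof.
move=> fg u; rewrite [u]path_algE /lin_ext !linear_sum; apply: eq_bigr => p _.
by rewrite !linearZ /= fg.
Qed.

End PathAlgModule.

Section PathAlgProduct.
Variables (A : comPzRingType) (Q : quiver).
Implicit Types (u v w : path_alg A Q) (p q : qpath Q).

Definition path_mul p q : path_alg A Q :=
  if psrc p == ptgt q then of_path (pcat p q) else 0.

Definition pmul u v : path_alg A Q :=
  lin_ext (fun p => lin_ext (path_mul p) v) u.

Definition vtx (x : vert Q) : path_alg A Q := of_path (vpath x).
Definition edg (e : edge Q) : path_alg A Q := of_path (epath e).

(* The unit element, when [Q] has finitely many vertices. *)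
Definition path_one : path_alg A Q := \sum_(x \in [set: vert Q]) vtx x.

Lemma pmul_linearr u : linear (pmul u).
Proof.
move=> a v w; rewrite /pmul /lin_ext scaler_sumr -big_split /=.
apply: eq_bigr => p _; rewrite -!/(lin_ext _ _) linearP scalerDr !scalerA.
by rewrite [a * _]mulrC.
Qed.

HB.instance Definition _ u :=
  GRing.isLinear.Build A (path_alg A Q) (path_alg A Q) *:%R (pmul u)
    (pmul_linearr u).

Definition pmulr v u := pmul u v.

Lemma pmulr_linear v : linear (pmulr v).
Proof. by move=> a u w; rewrite /pmulr /pmul linearP. Qed.

HB.instance Definition _ v :=
  GRing.isLinear.Build A (path_alg A Q) (path_alg A Q) *:%R (pmulr v)
    (pmulr_linear v).

Lemma pmul_path p q : pmul (of_path p) (of_path q) = path_mul p q.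
Proof. by rewrite /pmul !lin_ext_path. Qed.

Lemma pmul_cat p q : psrc p = ptgt q ->
  pmul (of_path p) (of_path q) = of_path (pcat p q).
Proof. by move=> pq; rewrite pmul_path /path_mul pq eqxx. Qed.

Lemma pmul_neq p q : psrc p != ptgt q -> pmul (of_path p) (of_path q) = 0.
Proof. by move=> pq; rewrite pmul_path /path_mul (negbTE pq). Qed.

Lemma pmul0r u : pmul 0 u = 0. Proof. exact: (linear0 (pmulr u)). Qed.
Lemma pmulr0 u : pmul u 0 = 0. Proof. exact: linear0. Qed.

Lemma pmulA u v w : pmul u (pmul v w) = pmul (pmul u v) w.
Proof.
apply: (lin_eq (f := pmulr (pmul v w)) (g := pmulr w \o pmulr v)) u => p /=.
rewrite /pmulr.
apply: (lin_eq (f := pmul (of_path p) \o pmulr w)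
               (g := pmulr w \o pmul (of_path p))) v => q /=.
rewrite /pmulr.
apply: (lin_eq (f := pmul (of_path p) \o pmul (of_path q))
               (g := pmul (pmul (of_path p) (of_path q)))) w => t /=.
have [pq|pq] := eqVneq (psrc p) (ptgt q); have [qt|qt] := eqVneq (psrc q) (ptgt t).
- have p_qt : psrc p = ptgt (pcat q t) by rewrite ptgt_pcat.
  have pq_t : psrc (pcat p q) = ptgt t by rewrite psrc_pcat.
  by rewrite (pmul_cat qt) (pmul_cat pq) (pmul_cat p_qt) (pmul_cat pq_t) pcatA.
- have pq_t : psrc (pcat p q) != ptgt t by rewrite psrc_pcat.
  by rewrite (pmul_neq qt) pmulr0 (pmul_cat pq) (pmul_neq pq_t).
- have p_qt : psrc p != ptgt (pcat q t) by rewrite ptgt_pcat.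
  by rewrite (pmul_neq pq) pmul0r (pmul_cat qt) (pmul_neq p_qt).
- by rewrite (pmul_neq pq) (pmul_neq qt) pmul0r pmulr0.
Qed.

End PathAlgProduct.

Arguments vtx {A Q} x.
Arguments edg {A Q} e.
Arguments path_one {A Q}.
Notation "u *p v" := (pmul u v) (at level 40, left associativity).

Record pre_graph (D : hecke_datum) := PreGraph {
  g_quiver :> quiver;
  g_lab : vert g_quiver -> set (hS D);
  g_fin : forall (x : vert g_quiver) (r : hS D), ~ g_lab x r ->
    finite_set [set e : edge g_quiver | tgt e = x /\ g_lab (src e) r]
}.

Section Rho.
Variables (D : hecke_datum) (G : pre_graph D).
Notation A := (hA D).

Definition rho_vtx (r : hS D) (x : vert G) : path_alg A G :=
  if r \in g_lab x then - (hb r *: vtx x)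
  else ha r *: vtx x
       + \sum_(e \in [set e : edge G | tgt e = x /\ g_lab (src e) r])
           (edg e : path_alg A G).

(* Left A[G]-linearity forces rho_r(p) = rho_r(p s(p)) = p rho_r(s(p)); see
   [rho_vtxE] and [rho_pmul] for the converse. *)
Definition rho (r : hS D) : path_alg A G -> path_alg A G :=
  lin_ext (fun p => of_path p *p rho_vtx r (psrc p)).

HB.instance Definition _ r := GRing.Linear.on (rho r).

Lemma vtx_rho_vtx r x : vtx x *p rho_vtx r x = rho_vtx r x.
Proof.
have vv : vtx x *p vtx x = vtx x :> path_alg A G.
  by rewrite pmul_cat // (pcat_vl (vpath x)).
rewrite /rho_vtx; case: ifP => [|/negbT]; first by rewrite linearN linearZ /= vv.
rewrite notin_setE => xr; rewrite linearD linearZ /= vv; congr (_ + _).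
rewrite !(fsbig_finite _ _ (g_fin xr)) /= linear_sum.
rewrite big_seq [RHS]big_seq; apply: eq_bigr => e.
rewrite in_fset_set ?inE; last exact: g_fin.
by case=> ex _; rewrite /= pmul_cat /= -ex // (pcat_vl (epath e)).
Qed.

Lemma rho_vtxE r x : rho r (vtx x) = rho_vtx r x.
Proof. by rewrite /rho lin_ext_path vtx_rho_vtx. Qed.

Lemma rho_pmul r u v : rho r (u *p v) = u *p rho r v.
Proof.
apply: (lin_eq (f := rho r \o pmulr v) (g := pmulr (rho r v))) u => p /=.
rewrite /pmulr.
apply: (lin_eq (f := rho r \o pmul (of_path p))
               (g := pmul (of_path p) \o rho r)) v => q /=.
rewrite [rho r (of_path q)]lin_ext_path pmulA pmul_path /path_mul.
case: eqP => [pq|_]; last by rewrite linear0 pmul0r.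
by rewrite /rho lin_ext_path psrc_pcat.
Qed.

End Rho.

Arguments rho {D} G r.

(* (f g f ...)_m, a composite of m factors *)
Fixpoint alternating (T : Type) (f g : T -> T) (m : nat) : T -> T :=
  if m is m'.+1 then f \o alternating g f m' else id.

Definition braid_diff (D : hecke_datum) (G : pre_graph D) (r s : hS D)
    (x : vert G) : path_alg (hA D) G :=
  alternating (rho G r) (rho G s) (cox_m r s) (vtx x)
  - alternating (rho G s) (rho G r) (cox_m r s) (vtx x).

Section Ideal.
Variables (E : ext_hecke_datum).
Notation A := (hA E).

Definition is_expansion (Q : quiver) (u : path_alg A Q)
    (X : qpath Q -> e_I E -> A) : Prop :=
  [/\ forall p i, X p i \in e_A0 E,
      finite_set [set ip : e_I E * qpath Q | X ip.2 ip.1 != 0] &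
      u = \sum_(ip \in [set: e_I E * qpath Q])
            (e_c ip.1 * X ip.2 ip.1) *: of_path ip.2].

Definition expansion (Q : quiver) (u : path_alg A Q) : qpath Q -> e_I E -> A :=
  xget (fun _ _ => 0) [set X | is_expansion u X].

(* X^{r,s,x}_{p,i} *)
Definition Xcoef (G : pre_graph E) (r s : hS E) (x : vert G) :
    qpath G -> e_I E -> A :=
  expansion (braid_diff r s x).

(* A_0[Q], as the subset of A[Q] of elements with coefficients in A_0 *)
Definition path_alg0 (Q : quiver) : set (path_alg A Q) :=
  [set u | forall p, coeff u p \in e_A0 E].

Definition two_sided_ideal (Q : quiver) (J : set (path_alg A Q)) : Prop :=
  [/\ J `<=` path_alg0 (Q := Q), J 0,
      forall u v, J u -> J v -> J (u - v) &
      forall u v, path_alg0 u -> J v -> J (u *p v) /\ J (v *p u)].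

Definition ideal_generated (Q : quiver) (X : set (path_alg A Q)) :
  set (path_alg A Q) := smallest (two_sided_ideal (Q := Q)) X.

Definition J0 (G : pre_graph E) : set (path_alg A G) :=
  ideal_generated [set u | exists (x : vert G) (i : e_I E) (r s : hS E),
    [/\ r <> s, (0 < cox_m r s)%N &
        u = \sum_(p \in [set: qpath G]) Xcoef r s x p i *: of_path p]].

End Ideal.

Arguments Xcoef {E G} r s x.
Arguments J0 {E} G.

Inductive univ_vert := Xr | Xs | Xempty | Xboth.

Definition univ_code (x : univ_vert) : bool * bool :=
  match x with
  | Xr => (true, false) | Xs => (false, true)
  | Xempty => (false, false) | Xboth => (true, true)
  end.

Definition univ_decode (c : bool * bool) : univ_vert :=
  match c with
  | (true, false) => Xr | (false, true) => Xs
  | (false, false) => Xempty | (true, true) => Xboth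
  end.

Lemma univ_codeK : cancel univ_code univ_decode. Proof. by case. Qed.

HB.instance Definition _ := Finite.copy univ_vert (can_type univ_codeK).

(* The edge (x, y) is the unique edge x <- y. *)
Definition univ_quiver : quiver :=
  @Quiver univ_vert (univ_vert * univ_vert)%type snd fst.

Definition univ_lab (T : Type) (r s : T) (x : univ_vert) : set T :=
  match x with
  | Xr => [set r] | Xs => [set s] | Xempty => set0 | Xboth => [set r; s]
  end.

Definition univ_graph (D : hecke_datum) (r s : hS D) : pre_graph D :=
  @PreGraph D univ_quiver (univ_lab r s)
    (fun x r' _ => @finite_finset (univ_vert * univ_vert)%type _).

Section Psi.
Variables (D : hecke_datum) (r s : hS D) (L : pre_graph D).
Notation A := (hA D).
Notation U := (univ_graph r s).

Definition Vclass (x : vert U) : set (vert L) :=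
  [set y | g_lab y `&` [set r; s] = g_lab x].

Definition psi_vtx (x : vert U) : path_alg A L :=
  \sum_(y \in Vclass x) (vtx y : path_alg A L).

Definition psi_edge (e : edge U) : path_alg A L :=
  \sum_(f \in [set f : edge L | Vclass (tgt e) (tgt f) /\
                                Vclass (src e) (src f)])
    (edg f : path_alg A L).

(* psi(e_1 ... e_n) = psi(e_1) ... psi(e_n) psi(s(e_n)).  For r <> s and finite
   L the resulting map is the A-algebra homomorphism prescribed on vertices and
   edges by [psi_vtx] and [psi_edge]: see [psi_of_vtx], [psi_of_edge],
   [psi_pmul] and [psi_one] below. *)
Definition psi_path (p : qpath U) : path_alg A L :=
  foldr (fun e u => psi_edge e *p u) (psi_vtx (psrc p)) (pedges p).

Definition psi : path_alg A U -> path_alg A L := lin_ext psi_path.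

HB.instance Definition _ := GRing.Linear.on psi.

(* The vertex x_y of the universal graph *)
Definition univ_of (y : vert L) : vert U :=
  match r \in g_lab y, s \in g_lab y with
  | true, false => Xr | false, true => Xs
  | false, false => Xempty | true, true => Xboth
  end.

Lemma lab_univ_of (y : vert L) :
  g_lab (univ_of y) = g_lab y `&` [set r; s].
Proof.
rewrite /univ_of; case: ifPn => [|]; case: ifPn => [|]; rewrite ?inE ?notin_setE;
  move=> ys yr; apply/seteqP; split=> z /=; rewrite ?inE; try tauto.
- by case=> ->; split; auto.
- by move=> ->; split; auto.
- by case=> zl [->//|zs]; rewrite zs in zl.
- by move=> ->; split; auto.
- by case=> zl [zr|->//]; rewrite zr in zl.
- by case=> zl [zr|zs]; [rewrite zr in zl|rewrite zs in zl].
Qed.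

Lemma univ_lab_inj : r <> s -> injective (univ_lab r s).
Proof.
move=> rs x y xy.
have /propeqP hr : univ_lab r s x r = univ_lab r s y r by rewrite xy.
have /propeqP hs : univ_lab r s x s = univ_lab r s y s by rewrite xy.
by case: x {xy} hr hs => /=; case: y => //=; intuition; exfalso; intuition congruence.
Qed.

Section PsiMorphism.
Hypothesis rs : r <> s.
Hypothesis finV : finite_set [set: vert L].
Hypothesis finE : finite_set [set: edge L].

Let finVS (X : set (vert L)) : finite_set X.
Proof. exact: sub_finite_set finV. Qed.
Let finES (X : set (edge L)) : finite_set X.
Proof. exact: sub_finite_set finE. Qed.

Let psi_vtxE (x : vert U) :
  psi_vtx x = \sum_(y <- fset_set (Vclass x)) (vtx y : path_alg A L).
Proof. by rewrite /psi_vtx fsbig_finite. Qed.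

Lemma vtx_mul_path (y : vert L) (p : qpath L) :
  vtx y *p of_path p = if y == ptgt p then of_path p else 0 :> path_alg A L.
Proof.
rewrite pmul_path /path_mul -[psrc _]/y.
by case: eqP => // ->; rewrite pcat_vl.
Qed.

Lemma path_mul_vtx (y : vert L) (p : qpath L) :
  of_path p *p vtx y = if psrc p == y then of_path p else 0 :> path_alg A L.
Proof.
rewrite pmul_path /path_mul -[ptgt _]/y.
by case: eqP => // <-; rewrite pcat_vr.
Qed.

Let pick (X : set (vert L)) (y : vert L) (w : path_alg A L) :
  \sum_(z <- fset_set X) (if z == y then w else 0) = if y \in X then w else 0.
Proof.
case: ifPn => yX.
  rewrite (bigD1_seq y) ?fset_uniq ?in_fset_set //= eqxx big1 ?addr0 // => z.
  by move/negbTE => ->.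
rewrite big_seq big1 // => z; rewrite in_fset_set // => zX.
by case: eqP => // zy; rewrite zy (negbTE yX) in zX.
Qed.

Lemma psi_vtx_mul_path (x : vert U) (p : qpath L) :
  psi_vtx x *p of_path p = if ptgt p \in Vclass x then of_path p else 0.
Proof.
rewrite psi_vtxE -/(pmulr (of_path p) _) linear_sum /= -pick.
by apply: eq_bigr => y _; rewrite /pmulr vtx_mul_path.
Qed.

Lemma path_mul_psi_vtx (x : vert U) (p : qpath L) :
  of_path p *p psi_vtx x = if psrc p \in Vclass x then of_path p else 0.
Proof.
rewrite psi_vtxE linear_sum /= -pick.
by apply: eq_bigr => y _; rewrite path_mul_vtx eq_sym.
Qed.

Lemma VclassP (x x' : vert U) (y : vert L) :
  y \in Vclass x -> (y \in Vclass x') = (x' == x).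
Proof.
rewrite inE => yx; apply/idP/eqP => [|->]; rewrite inE //.
by rewrite /Vclass /= yx => /(univ_lab_inj rs).
Qed.

Lemma psi_vtx_mul (x x' : vert U) :
  psi_vtx x *p psi_vtx x' = if x == x' then psi_vtx x' else 0.
Proof.
rewrite (psi_vtxE x') linear_sum /= -[RHS](fun_if (fun u => u)).
under eq_big_seq => y yx'.
  rewrite in_fset_set // in yx'.
  by rewrite psi_vtx_mul_path (VclassP x yx'); over.
by case: ifP => // _; rewrite big1.
Qed.

Let psi_edgeE (e : edge U) : psi_edge e =
  \sum_(f <- fset_set [set f : edge L | Vclass (tgt e) (tgt f) /\
                                        Vclass (src e) (src f)])
    (edg f : path_alg A L).
Proof. by rewrite /psi_edge fsbig_finite. Qed.

Lemma psi_vtx_mul_edge (x : vert U) (e : edge U) :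
  psi_vtx x *p psi_edge e = if x == tgt e then psi_edge e else 0.
Proof.
rewrite psi_edgeE linear_sum /=.
under eq_big_seq => f fe.
  have ft : tgt f \in Vclass (tgt e) by move: fe; rewrite in_fset_set ?inE // => -[].
  by rewrite psi_vtx_mul_path (VclassP x ft); over.
by case: ifP => // _; rewrite big1.
Qed.

Lemma psi_edge_mul_vtx (x : vert U) (e : edge U) :
  psi_edge e *p psi_vtx x = if x == src e then psi_edge e else 0.
Proof.
rewrite psi_edgeE -/(pmulr (psi_vtx x) _) linear_sum /=.
under eq_big_seq => f fe.
  have fs : src f \in Vclass (src e) by move: fe; rewrite in_fset_set ?inE // => -[].
  by rewrite /pmulr path_mul_psi_vtx psrc_epath (VclassP x fs); over.
by case: ifP => // _; rewrite big1.
Qed.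

Lemma psi_of_vtx (x : vert U) : psi (vtx x) = psi_vtx x.
Proof. by rewrite /psi lin_ext_path. Qed.

Lemma psi_of_edge (e : edge U) : psi (edg e) = psi_edge e.
Proof. by rewrite /psi lin_ext_path /psi_path /= psi_edge_mul_vtx eqxx. Qed.

Lemma psi_vtx_mul_psi_path (x : vert U) (p : qpath U) :
  psi_vtx x *p psi_path p = if x == ptgt p then psi_path p else 0.
Proof.
rewrite /psi_path /psrc; case: p => -[y es] /=; rewrite /ptgt /pedges /=.
case: es => [_|e es /= /andP[/eqP <- _]] /=; first exact: psi_vtx_mul.
by rewrite pmulA psi_vtx_mul_edge; case: ifP => // _; rewrite pmul0r.
Qed.

Lemma psi_path_cat (p q : qpath U) :
  psi_path p *p psi_path q =
  if psrc p == ptgt q then psi_path (pcat p q) else 0.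
Proof.
have -> : psi_path p *p psi_path q =
    foldr (fun e u => psi_edge e *p u) (psi_vtx (psrc p) *p psi_path q) (pedges p).
  rewrite {1}/psi_path; elim: (pedges p) => //= e es <-.
  by rewrite pmulA.
rewrite psi_vtx_mul_psi_path; case: eqP => [pq|_].
  by rewrite [psi_path (pcat p q)]/psi_path pedges_pcat // psrc_pcat // foldr_cat.
by elim: (pedges p) => //= e es ->; rewrite pmulr0.
Qed.

Lemma psi_pmul (u v : path_alg A U) : psi (u *p v) = psi u *p psi v.
Proof.
apply: (lin_eq (f := psi \o pmulr v) (g := pmulr (psi v) \o psi)) u => p /=.
rewrite /pmulr.
apply: (lin_eq (f := psi \o pmul (of_path p))
               (g := pmul (psi (of_path p)) \o psi)) v => q /=.
rewrite pmul_path /path_mul [psi (of_path p)]lin_ext_path.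
rewrite [psi (of_path q)]lin_ext_path psi_path_cat.
by case: eqP => _; rewrite ?linear0 // [LHS]lin_ext_path.
Qed.

Lemma psi_one : psi path_one = path_one.
Proof.
have finU : finite_set [set: vert U] by exact: (@finite_finset univ_vert).
pose F x y : path_alg A L := patch (fun=> 0) (Vclass x) vtx y.
transitivity (\sum_(x \in [set: vert U]) \sum_(y \in [set: vert L]) F x y).
  rewrite /path_one !(fsbig_finite _ _ finU) linear_sum; apply: eq_bigr => x _.
  by rewrite /= psi_of_vtx [LHS]fsbig_mkcond.
rewrite exchange_fsbig //; apply: eq_fsbigr => y _.
have yU : y \in Vclass (univ_of y) by rewrite inE /Vclass /= -lab_univ_of.
rewrite (fsbigD1 (univ_of y)) //= fsbig1 => [|x [_ xy]].
  by rewrite addr0 /F /patch yU.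
by rewrite /F /patch (VclassP x yU); case: eqP.
Qed.

End PsiMorphism.

End Psi.

Arguments Vclass {D r s L} x.
Arguments psi {D r s} L.
Arguments univ_of {D} r s {L} y.

(* Main.v *)
(** For [t] in [{r, s}] the map [psi] intertwines [rho U t] on the universal
    graph [U] with [rho L t].  Since each [rho L t] is left linear and
    [y = y psi(x_y)], the braid difference of [L] at [y] is [y psi(-)] applied
    to the braid difference of [U] at [x_y].  The map [u |-> y psi(u)] sends
    paths to elements with coefficients in [A_0], so it commutes with taking
    the [A_0]-coordinate along a basis element [c_i]: the two families of
    generators coincide. *)

Require Import Defs.
From mathcomp Require Import all_boot ssralg finmap.
From mathcomp Require Import boolp classical_sets functions cardinality fsbigop.
From mathcomp Require Import monalg.
Set Implicit Arguments.
Unset Strict Implicit.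
Unset Printing Implicit Defensive.
Import GRing.Theory.
Local Open Scope classical_set_scope.
Local Open Scope ring_scope.

(** * Finite sums over fibres and under linear maps *)

(** Once the fibre condition is an indicator, the sums can be exchanged, and for each [j] only the
    index [h j] survives. This serves to group the edges of [L], by target or by image in the
    universal quiver. *)
Lemma fsbig_fiber (V : nmodType) (I J : choiceType) (h : J -> I) (P : set I)
    (Q : set J) (F : J -> V) : finite_set P -> finite_set Q ->
  \sum_(i \in P) \sum_(j \in [set j | h j = i /\ Q j]) F j =
  \sum_(j \in [set j | P (h j) /\ Q j]) F j.
Proof.
move=> finP finQ.
transitivity (\sum_(i \in P) \sum_(j \in Q) if h j == i then F j else 0).
  apply: eq_fsbigr => i _.
  transitivity (\sum_(j \in Q `&` [set j | h j = i]) F j).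
    by apply: eq_fsbigl; apply/seteqP; split=> j [].
  rewrite fsbig_mkcondr; apply: eq_fsbigr => j _; case: eqP => ji.
    by rewrite ifT // inE.
  by rewrite ifF //; apply/negbTE; rewrite notin_setE.
rewrite exchange_fsbig //.
transitivity (\sum_(j \in Q `&` [set j | P (h j)]) F j); last first.
  by apply: eq_fsbigl; apply/seteqP; split=> j [].
rewrite fsbig_mkcondr; apply: eq_fsbigr => j _; case: ifPn.
  rewrite inE => /= Pj; rewrite (fsbigD1 (h j)) //= eqxx fsbig1 ?addr0 // => i [_ /= ij].
  by case: eqP => // ji; case: ij.
rewrite notin_setE => /= Pj; apply: fsbig1 => i Pi.
by case: eqP => // ji; rewrite ji in Pj.
Qed.

Lemma linear_fsum (R : pzRingType) (U V : lmodType R) (f : {linear U -> V})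
    (I : choiceType) (P : set I) (F : I -> U) : finite_set P ->
  f (\sum_(i \in P) F i) = \sum_(i \in P) f (F i).
Proof. by move=> finP; rewrite !fsbig_finite // linear_sum. Qed.

(** * The map [psi] intertwines [rho] on the universal graph with [rho] on [L] *)

Section Intertwining.
Variables (D : hecke_datum) (r s : hS D) (L : pre_graph D).
Hypothesis rs : r <> s.
Hypothesis finV : finite_set [set: vert L].
Hypothesis finE : finite_set [set: edge L].
Notation U := (univ_graph r s).

Let finVS (X : set (vert L)) : finite_set X.
Proof. exact: sub_finite_set finV. Qed.
Let finES (X : set (edge L)) : finite_set X.
Proof. exact: sub_finite_set finE. Qed.

Lemma Vclass_univ_of (y : vert L) : Vclass (univ_of r s y) y.
Proof. by rewrite /Vclass /= -lab_univ_of. Qed.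

(** As [r <> s], the four universal labels are distinct, so the classes are the fibres of
    [univ_of]. *)
Lemma VclassE (x : vert U) (y : vert L) : Vclass x y <-> univ_of r s y = x.
Proof.
split=> [xy | <-]; last exact: Vclass_univ_of.
by apply: (univ_lab_inj rs); rewrite -[RHS]xy; apply: lab_univ_of.
Qed.

Lemma Vclass_lab (t : hS D) (x : vert U) (y : vert L) :
  t = r \/ t = s -> Vclass x y -> g_lab x t <-> g_lab y t.
Proof. by move=> rst <-; split=> [[]//|yt]; split. Qed.

(** Whether [t] lies in the label is constant on the class of [x], so one case of [rho_vtx] applies
    to all its vertices. If [t] is not in the label, both sides sum the edges of [L] that end in the
    class and start at a vertex labelled by [t]: the left groups them by target, the right by
    universal edge. *)
Lemma rho_psi_vtx (t : hS D) (x : vert U) : t = r \/ t = s ->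
  rho L t (psi_vtx L x) = psi L (rho_vtx t x).
Proof.
move=> rst; rewrite linear_fsum // /rho_vtx /=.
have labE (y : vert L) : Vclass x y -> (t \in g_lab y) = (t \in g_lab (x : vert U)).
  by move=> xy; apply/idP/idP; rewrite !inE (Vclass_lab rst xy).
under eq_fsbigr => y yx.
  rewrite rho_vtxE /rho_vtx labE; last by rewrite inE in yx.
  over.
case: ifPn => [_|xt].
  rewrite linearN linearZ /= psi_of_vtx.
  rewrite -scaleNr /psi_vtx !fsbig_finite // scaler_sumr.
  by apply: eq_bigr => y _; rewrite scaleNr.
rewrite fsbig_split // linearD linearZ /= psi_of_vtx; congr (_ + _).
  by rewrite /psi_vtx !fsbig_finite // scaler_sumr.
rewrite linear_fsum; last exact: (@finite_finset (univ_vert * univ_vert)%type).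
rewrite fsbig_fiber //.
(* The fibre of [h] over a universal edge [e] is exactly the set of edges summed in [psi_edge e]. *)
pose h (f : edge L) : edge U := (univ_of r s (tgt f), univ_of r s (src f)).
transitivity (\sum_(e \in [set e : edge U | tgt e = x /\ g_lab (src e) t])
  \sum_(f \in [set f : edge L | h f = e /\ [set: edge L] f]) (edg f : path_alg (hA D) L)).
  rewrite fsbig_fiber //; last exact: (@finite_finset (univ_vert * univ_vert)%type).
  apply: eq_fsbigl; apply/seteqP; split=> f /=.
    move=> [/VclassE xf ft]; split=> //; split=> //.
    exact/(Vclass_lab rst (Vclass_univ_of (src f))).
  move=> [[xf ft] _]; split; first exact/VclassE.
  exact/(Vclass_lab rst (Vclass_univ_of (src f))).
apply: eq_fsbigr => -[x1 x2] _; rewrite /= psi_of_edge //; apply: eq_fsbigl.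
apply/seteqP; split=> f /=.
  by move=> [[<- <-] _]; split; apply: Vclass_univ_of.
by move=> [/VclassE f1 /VclassE f2]; split=> //; rewrite /h f1 f2.
Qed.

(** Writing a path as $p = p\,s(p)$ reduces to vertices, since [rho] is left linear and [psi] is
    multiplicative. *)
Lemma rho_psi (t : hS D) (u : path_alg (hA D) U) : t = r \/ t = s ->
  rho L t (psi L u) = psi L (rho U t u).
Proof.
move=> rst.
apply: (lin_eq (f := rho L t \o psi L) (g := psi L \o rho U t)) u => p /=.
have -> : of_path p = of_path p *p vtx (psrc p) :> path_alg (hA D) U.
  by rewrite pmul_cat // pcat_vr.
by rewrite psi_pmul // !rho_pmul psi_pmul // psi_of_vtx rho_psi_vtx // rho_vtxE.
Qed.

Lemma alternating_psi (t1 t2 : hS D) m (u : path_alg (hA D) U) :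
  t1 = r \/ t1 = s -> t2 = r \/ t2 = s ->
  alternating (rho L t1) (rho L t2) m (psi L u) =
  psi L (alternating (rho U t1) (rho U t2) m u).
Proof.
move=> rs1 rs2; elim: m t1 t2 rs1 rs2 => //= m IHm t1 t2 rs1 rs2.
by rewrite IHm // rho_psi.
Qed.

Lemma alternating_pmul (G : pre_graph D) (t1 t2 : hS D) m
    (u v : path_alg (hA D) G) :
  alternating (rho G t1) (rho G t2) m (u *p v) =
  u *p alternating (rho G t1) (rho G t2) m v.
Proof. by elim: m t1 t2 => //= m IHm t1 t2; rewrite IHm rho_pmul. Qed.

Lemma braid_diff_psi (y : vert L) :
  braid_diff r s y = vtx y *p psi L (braid_diff r s (univ_of r s y : vert U)).
Proof.
have alt t1 t2 m : t1 = r \/ t1 = s -> t2 = r \/ t2 = s ->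
    alternating (rho L t1) (rho L t2) m (vtx y) =
    vtx y *p psi L
      (alternating (rho U t1) (rho U t2) m (vtx (univ_of r s y : vert U))).
  move=> rs1 rs2.
  have vy : vtx y = vtx y *p psi L (vtx (univ_of r s y : vert U))
      :> path_alg (hA D) L.
    rewrite psi_of_vtx path_mul_psi_vtx // ifT // inE.
    exact: Vclass_univ_of.
  rewrite [in LHS]vy; apply: etrans; first exact: alternating_pmul.
  by congr pmul; exact: alternating_psi.
rewrite /braid_diff (linearB (psi L)) (linearB (pmul (vtx y))).
by congr (_ - _); apply: alt; auto.
Qed.

End Intertwining.

(** * Coordinates of elements of $A$ in the $A_0$-basis *)

Section Coordinates.
Variables (A : comPzRingType) (A0 : subringClosed A) (I : choiceType) (c : I -> A).
Hypothesis basis_c : is_basis A0 c.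

Definition coord (a : A) : I -> A := sval (cid (basis_c a)).

Lemma coordP (a : A) :
  [/\ forall i, coord a i \in A0, finite_set [set i | coord a i != 0] &
      a = \sum_(i \in [set: I]) c i * coord a i].
Proof. by rewrite /coord; case: cid => x []. Qed.

Lemma coord_eq (a : A) (x : I -> A) : (forall i, x i \in A0) ->
  finite_set [set i | x i != 0] -> a = \sum_(i \in [set: I]) c i * x i ->
  coord a = x.
Proof. by rewrite /coord => x0 xfin ax; case: cid => y [_ uy] /=; apply: uy. Qed.

Lemma coordD (a b : A) i : coord (a + b) i = coord a i + coord b i.
Proof.
have [a0 afin aE] := coordP a; have [b0 bfin bE] := coordP b.
have finU := conj afin bfin; rewrite -finite_setU in finU.
suff -> : coord (a + b) = (fun i => coord a i + coord b i) by [].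
(* All three coordinate sums are taken over the union of the two supports, where they add
   termwise. *)
have out j : j \notin fset_set ([set i | coord a i != 0] `|` [set i | coord b i != 0]) ->
    coord a j = 0 /\ coord b j = 0.
  rewrite in_fset_set // notin_setE => /not_orP[/= /negP + /negP].
  by rewrite !negbK => /eqP -> /eqP ->.
apply: coord_eq => [j||].
- exact: rpredD.
- apply: sub_finite_set finU => j /=; apply: contra_neqP.
  by move=> /not_orP[/negP + /negP]; rewrite !negbK => /eqP -> /eqP ->; rewrite addr0.
- rewrite {1}aE {1}bE.
  rewrite !(fsbigTE (fset_set ([set i | coord a i != 0] `|` [set i | coord b i != 0]))).
  + by rewrite -big_split; apply: eq_bigr => j _; rewrite mulrDr.
  + by move=> j /out[-> ->]; rewrite addr0 mulr0.
  + by move=> j /out[_ ->]; rewrite mulr0.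
  + by move=> j /out[-> _]; rewrite mulr0.
Qed.

(** The products [coord a i * n] stay in $A_0$ because [n] does, so uniqueness of coordinates
    applies. *)
Lemma coordM (a n : A) i : n \in A0 -> coord (a * n) i = coord a i * n.
Proof.
move=> n0; have [a0 afin aE] := coordP a.
suff -> : coord (a * n) = (fun i => coord a i * n) by [].
have out j : j \notin fset_set [set i | coord a i != 0] -> coord a j = 0.
  by rewrite in_fset_set // notin_setE => /negP; rewrite negbK => /eqP.
apply: coord_eq => [j||].
- exact: rpredM.
- by apply: sub_finite_set afin => j /=; apply: contra_neq => ->; rewrite mul0r.
- rewrite {1}aE !(fsbigTE (fset_set [set i | coord a i != 0])).
  + by rewrite mulr_suml; apply: eq_bigr => j _; rewrite mulrA.
  + by move=> j /out ->; rewrite mul0r mulr0.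
  + by move=> j /out ->; rewrite mulr0.
Qed.

Lemma coord0 i : coord 0 i = 0.
Proof. by rewrite -[X in coord X](mulr0 0) coordM ?rpred0 // mulr0. Qed.

End Coordinates.

(** * Expansions in the path algebra and their $A_0$-coordinates *)

Section Expansion.
Variable E : ext_hecke_datum.
Notation A := (hA E).
Notation I := (e_I E).
Notation c := (@e_c E).
Notation coord := (coord (@e_basis E)).
Variable Q : quiver.
Implicit Types (u v : path_alg A Q) (p q : qpath Q) (i : I).

Lemma coeff_of_path p q : coeff (of_path p : path_alg A Q) q = (p == q)%:R.
Proof. by rewrite /coeff unlock [LHS]mcoeffU. Qed.

Lemma coeff0 p : coeff (0 : path_alg A Q) p = 0.
Proof. exact: mcoeff0. Qed.

Lemma coeff_sum (J : Type) (r : seq J) (P : pred J) (F : J -> path_alg A Q) p :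
  coeff (\sum_(j <- r | P j) F j) p = \sum_(j <- r | P j) coeff (F j) p.
Proof. exact: (big_morph (fun u => coeff u p) (fun u v => coeffD u v p) (coeff0 p)). Qed.

(** Only the pairs with path [q] contribute. The finiteness hypothesis guards against the default
    value 0 of a sum with infinite support. *)
Lemma coeff_expand (X : qpath Q -> I -> A) q :
  finite_set [set ip : I * qpath Q | X ip.2 ip.1 != 0] ->
  coeff (\sum_(ip \in [set: I * qpath Q]) (c ip.1 * X ip.2 ip.1) *: of_path ip.2) q
  = \sum_(i \in [set: I]) c i * X q i.
Proof.
move=> finX.
have out ip : ip \notin fset_set [set ip : I * qpath Q | X ip.2 ip.1 != 0] ->
    X ip.2 ip.1 = 0.
  by rewrite in_fset_set // notin_setE => /negP; rewrite negbK => /eqP.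
rewrite (fsbigTE (fset_set [set ip : I * qpath Q | X ip.2 ip.1 != 0])); last first.
  by move=> ip /out ->; rewrite mulr0 scale0r.
rewrite coeff_sum.
rewrite -(fsbigTE _ (fun ip => coeff ((c ip.1 * X ip.2 ip.1) *: of_path ip.2) q));
  last by move=> ip /out ->; rewrite mulr0 scale0r coeff0.
transitivity (\sum_(ip \in [set ip : I * qpath Q | ip.2 = q]) c ip.1 * X ip.2 ip.1).
  rewrite [RHS]fsbig_mkcond; apply: eq_fsbigr => ip _.
  rewrite coeffZ coeff_of_path /patch; case: eqP => ipq.
    by rewrite ifT ?inE // mulr1.
  by rewrite ifF ?mulr0 //; apply/negbTE; rewrite notin_setE.
apply: (reindex_fsbig (fun i => (i, q))); split=> //.
- by move=> i j _ _ [].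
- by move=> [i p] /= ->; exists i.
Qed.

Lemma expansion_coord u : is_expansion u (fun p => coord (coeff u p)).
Proof.
have finX : finite_set [set ip : I * qpath Q | coord (coeff u ip.2) ip.1 != 0].
  (* The support lies over the finitely many paths of [u], with finitely many basis indices over
     each. *)
  apply: (@sub_finite_set _ _ (\bigcup_(p in [set` msupp u])
    ((fun i => (i, p)) @` [set i | coord (coeff u p) i != 0]))).
    move=> [i p] /= ip; exists p => /=; last by exists i.
    by rewrite -mcoeff_neq0; apply: contra_neq ip; rewrite /coeff => ->; rewrite coord0.
  apply: bigcup_finite => // p _; apply: finite_image.
  by have [] := coordP (@e_basis E) (coeff u p).
split=> // [p i|]; first by have [] := coordP (@e_basis E) (coeff u p).
apply: coeffP => q.
apply: etrans (esym (@coeff_expand (fun p => coord (coeff u p)) q finX)).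
by have [] := coordP (@e_basis E) (coeff u q).
Qed.

(** The choice made by [xget] is harmless: comparing coefficients at [p], any expansion gives the
    unique coordinates of [coeff u p]. *)
Lemma expansionE u p i : expansion u p i = coord (coeff u p) i.
Proof.
have [X0 finX uE] : is_expansion u (expansion u).
  exact: (xgetI _ (expansion_coord u)).
suff -> : coord (coeff u p) = expansion u p by [].
apply: coord_eq => [j||]; first exact: X0.
- apply: sub_finite_set (finite_image (fun ip : I * qpath Q => ip.1) finX) => j /= jX.
  by exists (j, p).
- by rewrite {1}uE coeff_expand.
Qed.

Lemma expansion_sum u :
  u = \sum_(ip \in [set: I * qpath Q]) (c ip.1 * expansion u ip.2 ip.1) *: of_path ip.2.
Proof. by have [_ _] := xgetI (fun _ _ => 0) (expansion_coord u). Qed.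

(** This is the shape of the generators of [J0], see [coord_partE]. Summing over the finite support
    lets linear maps pass through directly. *)
Definition coord_part i u : path_alg A Q :=
  \sum_(p <- msupp u) coord (coeff u p) i *: of_path p.

Lemma coeff_coord_part i u q : coeff (coord_part i u) q = coord (coeff u q) i.
Proof.
rewrite /coord_part coeff_sum; under eq_bigr do rewrite coeffZ coeff_of_path.
have [qu|qu] := boolP (q \in msupp u).
  rewrite (bigD1_seq q) ?fset_uniq //= eqxx mulr1 big1 ?addr0 // => p /negbTE ->.
  by rewrite mulr0.
rewrite big_seq big1 => [|p pu].
  by move: qu; rewrite -mcoeff_eq0 => /eqP; rewrite /coeff => ->; rewrite coord0.
by case: eqP => [pq|]; rewrite ?mulr0 //; rewrite pq (negbTE qu) in pu.
Qed.

Lemma coord_partD i u v : coord_part i (u + v) = coord_part i u + coord_part i v.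
Proof. by apply: coeffP => p; rewrite !(coeffD, coeff_coord_part) coordD. Qed.

Lemma coord_part0 i : coord_part i 0 = 0.
Proof. by apply: coeffP => p; rewrite coeff_coord_part !coeff0 coord0. Qed.

Lemma coord_partZ i a u : path_alg0 u -> coord_part i (a *: u) = coord a i *: u.
Proof.
by move=> u0; apply: coeffP => p; rewrite !(coeffZ, coeff_coord_part) coordM.
Qed.

Lemma path_alg0_path p : path_alg0 (of_path p : path_alg A Q).
Proof. by move=> q; rewrite coeff_of_path rpred_nat. Qed.

Lemma path_alg0_0 : path_alg0 (0 : path_alg A Q).
Proof. by move=> q; rewrite coeff0 rpred0. Qed.

Lemma path_alg0_sum (J : Type) (r : seq J) (P : pred J) (F : J -> path_alg A Q) :
  (forall j, P j -> path_alg0 (F j)) -> path_alg0 (\sum_(j <- r | P j) F j).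
Proof. by move=> F0 p; rewrite coeff_sum rpred_sum // => j /F0. Qed.

Lemma path_alg0_mul u v : path_alg0 u -> path_alg0 v -> path_alg0 (u *p v).
Proof.
move=> u0 v0; apply: path_alg0_sum => p _ q; rewrite coeffZ rpredM //.
move: q; apply: path_alg0_sum => q _ t; rewrite coeffZ rpredM //.
by rewrite /path_mul; case: ifP => _; [apply: path_alg0_path|apply: path_alg0_0].
Qed.

(** The identity yields the generators in the definition of [J0]; [psi] yields the sums of
    [psi L (of_path p)] in the second generating set. *)
Lemma linear_coord_part (M : lmodType A) (f : {linear path_alg A Q -> M}) i u :
  f (coord_part i u) =
  \sum_(p \in [set: qpath Q]) expansion u p i *: f (of_path p).
Proof.
rewrite (fsbigTE (msupp u)) => [|p]; last first.
  by rewrite -mcoeff_eq0 expansionE /coeff => /eqP ->; rewrite coord0 scale0r.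
rewrite /coord_part linear_sum; apply: eq_bigr => p _.
by rewrite linearZ expansionE.
Qed.

Lemma coord_partE i u :
  coord_part i u = \sum_(p \in [set: qpath Q]) expansion u p i *: of_path p.
Proof. exact: (linear_coord_part idfun). Qed.

End Expansion.

(** * Coordinates under linear maps, and comparison of the generators *)

(** On a term $a\,p$ the image $a f(p)$ has $i$-th coordinate $a_i f(p)$, because $f(p)$ has
    coefficients in $A_0$ and coordinates are $A_0$-linear. *)
Lemma coord_part_linear (E : ext_hecke_datum) (Q Q' : quiver)
    (f : {linear path_alg (hA E) Q -> path_alg (hA E) Q'}) (i : e_I E)
    (u : path_alg (hA E) Q) :
  (forall p : qpath Q, path_alg0 (f (of_path p))) ->
  coord_part i (f u) = f (coord_part i u).
Proof.
move=> f0; rewrite {1}[u]path_algE /lin_ext /coord_part !linear_sum /=.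
rewrite -/(coord_part _ _) (big_morph _ (coord_partD i) (coord_part0 _ i)).
apply: eq_bigr => p _; rewrite !linearZ /=; exact: coord_partZ.
Qed.

(** The image of a path is a product of finite sums of paths, and $A_0[\Lambda]$ is closed under
    sums and products. *)
Lemma path_alg0_psi_path (E : ext_hecke_datum) (r s : hS E) (L : pre_graph E)
    (finV : finite_set [set: vert L]) (finE : finite_set [set: edge L])
    (p : qpath (univ_graph r s)) : path_alg0 (psi_path L p).
Proof.
rewrite /psi_path; elim: (pedges p) => [|e es IHes] /=.
  rewrite /psi_vtx fsbig_finite; last exact: sub_finite_set finV.
  by apply: path_alg0_sum => y _; apply: path_alg0_path.
apply: path_alg0_mul => //; rewrite /psi_edge fsbig_finite.
  by apply: path_alg0_sum => f _; apply: path_alg0_path.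
exact: sub_finite_set finE.
Qed.

Theorem theorem6p3 (E : ext_hecke_datum) (L : pre_graph E)
    (finV : finite_set [set: vert L]) (finE : finite_set [set: edge L]) :
  (forall (y : vert L) (r s : hS E), r <> s -> (0 < cox_m r s)%N ->
     alternating (rho L r) (rho L s) (cox_m r s) (vtx y)
     - alternating (rho L s) (rho L r) (cox_m r s) (vtx y)
     = vtx y *p psi L
         (\sum_(ip \in [set: e_I E * qpath (univ_graph r s)])
            (e_c ip.1 * Xcoef r s (univ_of r s y) ip.2 ip.1) *: of_path ip.2))
  /\
  J0 L = ideal_generated
    [set u | exists (r s : hS E) (i : e_I E) (y : vert L),
      [/\ r <> s, (0 < cox_m r s)%N &
          u = vtx y *p
                (\sum_(p \in [set: qpath (univ_graph r s)])
                   Xcoef r s (univ_of r s y) p i *: psi L (of_path p))]].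
Proof.
split=> [y r s rs _|].
  apply: etrans (braid_diff_psi rs finV finE y) _; congr (pmul _ (psi L _)).
  exact: expansion_sum.
(* The generators agree one by one for equal indices: both are the $i$-th coordinate of the braid
   difference of [L] at [y]. *)
have gen (r s : hS E) (i : e_I E) (y : vert L) : r <> s ->
    \sum_(p \in [set: qpath L]) Xcoef r s y p i *: of_path p =
    vtx y *p (\sum_(p \in [set: qpath (univ_graph r s)])
                Xcoef r s (univ_of r s y) p i *: psi L (of_path p)).
  move=> rs; apply: etrans (esym (coord_partE i _)) _.
  rewrite (braid_diff_psi rs finV finE y).
  have psi0 (p : qpath (univ_graph r s)) : path_alg0 (psi L (of_path p)).
    by rewrite /psi lin_ext_path; apply: path_alg0_psi_path.
  rewrite -(linear_coord_part (psi L)).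
  rewrite (coord_part_linear (f := pmul (vtx y) \o psi L)) // => p.
  by apply: path_alg0_mul; [exact: path_alg0_path|exact: psi0].
congr ideal_generated; apply/seteqP; split=> u /=.
  by move=> [y [i [r [s [rs m0 ->]]]]]; exists r, s, i, y; rewrite gen.
by move=> [r [s [i [y [rs m0 ->]]]]]; exists y, i, r, s; rewrite gen.
Qed.
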